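(* Up to isomorphism, the two-dimensional endo-commutative straight algebras over $\mathbb F_2$ are exactly classified into the thirteen algebras $ECS^2_1,\dots,ECS^2_{13}$ whose multiplication tables on a linear base $\{e,f\}$ are, respectively, $$\begin{pmatrix}f&0\\ f&0\end{pmatrix},\ \begin{pmatrix}f&f\\ 0&0\end{pmatrix},\ \begin{pmatrix}f&e+f\\ e&f\end{pmatrix},\ \begin{pmatrix}f&e\\ e+f&f\end{pmatrix},\ \begin{pmatrix}f&e\\ e&e+f\end{pmatrix},\ \begin{pmatrix}f&0\\ 0&e\end{pmatrix},\ \begin{pmatrix}f&e+f\\ e+f&e\end{pmatrix},$$ $$\begin{pmatrix}f&0\\ 0&0\end{pmatrix},\ \begin{pmatrix}f&f\\ f&0\end{pmatrix},\ \begin{pmatrix}f&f\\ f&f\end{pmatrix},\ \begin{pmatrix}f&e\\ e&f\end{pmatrix},\ \begin{pmatrix}f&f\\ e&e\end{pmatrix},\ \begin{pmatrix}f&e\\ f&e\end{pmatrix}.$$ That is, each of these thirteen algebras is endo-commutative and straight, no two of them are isomorphic, and every two-dimensional endo-commutative straight algebra over $\mathbb F_2$ is isomorphic to one of them.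
   Context: An algebra over the two-element field $\mathbb F_2$ is an $\mathbb F_2$-vector space with a bilinear multiplication, not assumed associative, commutative or unital. An algebra $A$ is endo-commutative if $x^2y^2=(xy)^2$ for all $x,y\in A$. A two-dimensional algebra is curled if, for every element $x$, the square $x^2$ is a scalar multiple of $x$; it is straight if it is not curled. The multiplication table of an algebra on a linear base $\{e,f\}$ is the array $\begin{pmatrix}e^2&ef\\ fe&f^2\end{pmatrix}$. *)

(* Defs.v *)
From HB Require Import structures.
From mathcomp Require Import all_boot all_algebra.

Set Implicit Arguments.
Unset Strict Implicit.
Unset Printing Implicit Defensive.

Import GRing.Theory.
Local Open Scope ring_scope.

(* MathComp has no structure of non-associative algebra: an algebra on V is    *)
(* given by its multiplication, an arbitrary bilinear map V -> V -> V.         *)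

Definition endo_commutative (K : fieldType) (V : vectType K)
    (mul : {bilinear V -> V -> V}) : Prop :=
  forall x y : V, mul (mul x x) (mul y y) = mul (mul x y) (mul x y).

Definition curled (K : fieldType) (V : vectType K)
    (mul : {bilinear V -> V -> V}) : Prop :=
  forall x : V, exists a : K, mul x x = a *: x.

Definition straight (K : fieldType) (V : vectType K)
    (mul : {bilinear V -> V -> V}) : Prop :=
  ~ curled mul.

Definition isomorphic_algebras (K : fieldType) (V W : vectType K)
    (mulV : {bilinear V -> V -> V}) (mulW : {bilinear W -> W -> W}) : Prop :=
  exists phi : {linear V -> W},
    bijective phi /\ forall x y : V, phi (mulV x y) = mulW (phi x) (phi y).

(* The multiplication on K^n whose table on the canonical base 'e_0, 'e_1, ... *)
(* is T, i.e. 'e_i 'e_j = T i j.                                               *)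
Definition table_mul (K : fieldType) (n : nat) (T : 'M['rV[K]_n]_n)
    (x y : 'rV[K]_n) : 'rV[K]_n :=
  \sum_i \sum_j (x 0 i * y 0 j) *: T i j.

Lemma table_mul_is_bilinear (K : fieldType) (n : nat) (T : 'M['rV[K]_n]_n) :
  bilinear_for
    (GRing.Scale.Law.clone _ _ *:%R _) (GRing.Scale.Law.clone _ _ *:%R _)
    (table_mul T).
Proof.
split=> [v|u] a x y /=; rewrite /table_mul scaler_sumr -big_split /=;
  apply: eq_bigr => i _; rewrite scaler_sumr -big_split /=;
  apply: eq_bigr => j _; rewrite scalerA -scalerDl !mxE.
- by rewrite mulrDl mulrA.
- by rewrite mulrDr mulrCA.
Qed.

HB.instance Definition _ (K : fieldType) (n : nat) (T : 'M['rV[K]_n]_n) :=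
  bilinear_isBilinear.Build K 'rV[K]_n 'rV[K]_n 'rV[K]_n _ _ (table_mul T)
    (table_mul_is_bilinear T).

Lemma table_mul_delta (K : fieldType) (n : nat) (T : 'M['rV[K]_n]_n)
    (i j : 'I_n) : table_mul T 'e_i 'e_j = T i j.
Proof.
rewrite /table_mul (bigD1 i) //= (bigD1 j) //= !mxE !eqxx mulr1 scale1r.
rewrite big1 ?addr0 => [|k /negPf nkj]; last by rewrite !mxE nkj mulr0 scale0r.
rewrite big1 ?addr0 // => k /negPf nki; rewrite big1 // => l _.
by rewrite !mxE nki mul0r scale0r.
Qed.

Definition table2 (K : fieldType) (ee ef fe ff : 'rV[K]_2) : 'M['rV[K]_2]_2 :=
  \matrix_(i, j) if i == 0 then (if j == 0 then ee else ef)
                 else (if j == 0 then fe else ff).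

Local Notation e := ('e_0 : 'rV['F_2]_2).
Local Notation f := ('e_1 : 'rV['F_2]_2).

Definition ECS_tables : 13.-tuple 'M['rV['F_2]_2]_2 :=
  [tuple
    table2 f 0
           f 0;
    table2 f f
           0 0;
    table2 f (e + f)
           e f;
    table2 f e
           (e + f) f;
    table2 f e
           e (e + f);
    table2 f 0
           0 e;
    table2 f (e + f)
           (e + f) e;
    table2 f 0
           0 0;
    table2 f f
           f 0;
    table2 f f
           f f;
    table2 f e
           e f;
    table2 f f
           e e;
    table2 f e
           f e].

(* Indices start at 0: ECS k is the algebra ECS^2_(k+1).                       *)
Definition ECS (k : 'I_13) : {bilinear 'rV['F_2]_2 -> 'rV['F_2]_2 -> 'rV['F_2]_2} :=
  table_mul (tnth ECS_tables k).

(* Main.v *)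
Require Import Defs.
From HB Require Import structures.
From mathcomp Require Import all_boot all_algebra.

Set Implicit Arguments.
Unset Strict Implicit.
Unset Printing Implicit Defensive.

Import GRing.Theory.
Local Open Scope ring_scope.

(** Over F_2 the only multiples of x are 0 and x, so an algebra A of dimension
    2 is straight exactly when it has an element x whose square y = x^2 is
    neither 0 nor x. Then x is not 0 and (x, y) is a base of A, on which the
    multiplication is determined by the coordinates of xy, yx and y^2: a triple
    t of vectors of F_2^2, hence one of 64 possibilities. This relation between
    A, x and t is [presents mul x t]. A given A has at most three choices of x,
    hence at most three such triples, and the set of these triples is a
    complete invariant:
    - an isomorphism maps an x with triple t to an element with the same triple
      ([presents_morph]);
    - two algebras that share a triple are isomorphic, by matching the two
      bases ([presents_isomorphic]).

    The coordinates on the base (x, y) identify A with the algebra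
    [plane_mul t] on F_2^2 ([presents_mul]), in which everything can be
    computed. Three finite checks then give the classification. The triples of
    the thirteen tables, read off at x = e, define endo-commutative algebras
    ([ECS_triples_endo]). None of them occurs at any element of the algebra
    of another one ([ECS_triples_separated]), so no two of the algebras are
    isomorphic. And each of the 64 triples whose algebra is endo-commutative
    has an element where one of the thirteen triples occurs
    ([ECS_triples_exhaustive]), so every endo-commutative straight algebra
    shares a triple with one of the thirteen. *)

Local Notation plane := (('F_2)^o * ('F_2)^o)%type.
Local Notation triple := (plane * plane * plane)%type.

(** * Presentation of an algebra by an element and its square *)

Definition comb (U : lmodType 'F_2) (x y : U) (p : plane) : U :=
  p.1 *: x + p.2 *: y.

Lemma comb_is_linear (U : lmodType 'F_2) (x y : U) : linear (comb x y).
Proof.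
by move=> a p q; rewrite /comb scalerDr !scalerA addrACA -!scalerDl.
Qed.

HB.instance Definition _ (U : lmodType 'F_2) (x y : U) :=
  GRing.isLinear.Build 'F_2 plane U _ (comb x y) (comb_is_linear x y).

(** With (e, f) the canonical base of F_2^2, this is the bilinear
    multiplication such that e^2 = f and (ef, fe, f^2) = t. Unlike matrices,
    pairs of elements of F_2 compute, so that identities in this algebra can be
    checked by evaluation. *)
Definition plane_mul (t : triple) (p q : plane) : plane :=
  (p.1 * q.1) *: ((0, 1) : plane) + (p.1 * q.2) *: t.1.1
  + (p.2 * q.1) *: t.1.2 + (p.2 * q.2) *: t.2.

(** The multiplication is a bare function and the relation a boolean so that
    the same notion applies to abstract algebras and, as a program, to
    [plane_mul]. *)
Definition presents (U : lmodType 'F_2) (mul : U -> U -> U) (x : U)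
    (t : triple) : bool :=
  let y := mul x x in
  [&& y != 0, y != x, mul x y == comb x y t.1.1, mul y x == comb x y t.1.2
    & mul y y == comb x y t.2].

Lemma presents_morph (U W : lmodType 'F_2) (mulU : U -> U -> U)
    (mulW : W -> W -> W) (phi : {linear U -> W}) (x : U) (t : triple) :
  injective phi -> (forall y z, phi (mulU y z) = mulW (phi y) (phi z)) ->
  presents mulW (phi x) t = presents mulU x t.
Proof.
move=> phi_inj phiM.
have phi_comb (y z : U) p : comb (phi y) (phi z) p = phi (comb y z p).
  by rewrite /comb linearD !linearZ.
rewrite /presents -!phiM !phi_comb !(inj_eq phi_inj).
by rewrite -(inj_eq phi_inj (mulU x x) 0) linear0.
Qed.

Definition F2_elements : seq 'F_2 := [:: 0; 1].

Lemma mem_F2_elements (a : 'F_2) : a \in F2_elements.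
Proof. by case: a => [[|[|n]] ltn2] //; rewrite !inE -!val_eqE. Qed.

Lemma scalar_multiple_F2 (U : lmodType 'F_2) (x y : U) :
  (y = 0 \/ y = x) <-> (exists a : 'F_2, y = a *: x).
Proof.
split=> [[->|->] | [a ->]].
- by exists 0; rewrite scale0r.
- by exists 1; rewrite scale1r.
by have := mem_F2_elements a; rewrite !inE => /orP[]/eqP->;
  rewrite ?scale0r ?scale1r; [left | right].
Qed.

Lemma comb_bijective (V : vectType 'F_2) (x y : V) :
  \dim (fullv : {vspace V}) = 2%N -> x != 0 -> y != 0 -> y != x ->
  bijective (comb x y).
Proof.
move=> dimV x0 y0 yx; pose X := [tuple y; x].
have freeX : free X.
  rewrite free_cons seq1_free x0 span_seq1 andbT; apply/negP => /vlineP.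
  by move=> /scalar_multiple_F2[]/eqP; apply/negP.
have basisX : basis_of fullv X by rewrite basisEfree freeX subvf dimV.
exists (fun v => (coord X 1 v, coord X 0 v)) => [[a b] | v].
  rewrite /comb /= !linearD !linearZ /=.
  have X1 := coord_free 1 1 freeX; have X0 := coord_free 0 0 freeX.
  have X10 := coord_free 1 0 freeX; have X01 := coord_free 0 1 freeX.
  move: X1 X0 X10 X01 => /= -> -> -> ->.
  by rewrite !mulr0 !mulr1 addr0 add0r.
have lift01 : lift ord0 ord0 = 1 :> 'I_2 by apply: val_inj.
rewrite {3}(coord_basis basisX (memvf v)) !big_ord_recl big_ord0 addr0 lift01.
by rewrite addrC.
Qed.

Lemma square_neq0 (V : vectType 'F_2) (mul : {bilinear V -> V -> V}) (x : V) :
  mul x x != 0 -> x != 0.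
Proof. by apply: contraNneq => ->; rewrite linear0l. Qed.

Lemma presents_bijective (V : vectType 'F_2) (mul : {bilinear V -> V -> V})
    (x : V) (t : triple) :
  \dim (fullv : {vspace V}) = 2%N -> presents mul x t ->
  bijective (comb x (mul x x)).
Proof.
move=> dimV /and3P[xx0 xxx _]; apply: comb_bijective => //.
exact: square_neq0 xx0.
Qed.

Lemma presents_mul (V : vectType 'F_2) (mul : {bilinear V -> V -> V}) (x : V)
    (t : triple) (p q : plane) :
  presents mul x t ->
  comb x (mul x x) (plane_mul t p q)
  = mul (comb x (mul x x) p) (comb x (mul x x) q).
Proof.
case/and5P=> _ _ /eqP xy /eqP yx /eqP yy.
have comb01 : comb x (mul x x) (0, 1) = mul x x.
  by rewrite /comb scale0r add0r scale1r.
rewrite [in RHS]/comb linearDr !linearZr_LR /= !linearDl !linearZl_LR /=.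
rewrite /plane_mul 3!(linearD (comb x _)) 4!(linearZ_LR (comb x _)) /= comb01.
rewrite -xy -yx -yy !scalerDr !scalerA.
by rewrite addrACA addrA !(mulrC p.1) !(mulrC p.2).
Qed.

(** The triples of an algebra can be found inside its coordinate algebra: this
    is what reduces questions on abstract algebras to computations. *)
Lemma presents_comb (V : vectType 'F_2) (mul : {bilinear V -> V -> V}) (x : V)
    (t t' : triple) (p : plane) :
  \dim (fullv : {vspace V}) = 2%N -> presents mul x t ->
  presents mul (comb x (mul x x) p) t' = presents (plane_mul t) p t'.
Proof.
move=> dimV pres; apply: presents_morph => [|q r]; last exact: presents_mul.
exact: bij_inj (presents_bijective dimV pres).
Qed.

Lemma presents_straight (V : vectType 'F_2) (mul : {bilinear V -> V -> V})
    (x : V) (t : triple) : presents mul x t -> straight mul.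
Proof.
case/and3P=> xx0 xxx _ /(_ x) /scalar_multiple_F2[]/eqP; exact/negP.
Qed.

Lemma straight_presented (V : vectType 'F_2) (mul : {bilinear V -> V -> V}) :
  \dim (fullv : {vspace V}) = 2%N -> straight mul ->
  exists x t, presents mul x t.
Proof.
move=> dimV str.
have [x xx0 xxx] : exists2 x, mul x x != 0 & mul x x != x.
  (* V is finite, being identified with row vectors over F_2: the negation in
     the definition of straight yields a witness by search. *)
  pose r2v := @VectorInternalTheory.r2v 'F_2 V.
  pose good r := (mul (r2v r) (r2v r) != 0) && (mul (r2v r) (r2v r) != r2v r).
  have [r /andP[] | none] := pickP good; first by exists (r2v r).
  case: str => x; apply/scalar_multiple_F2.
  have := none (VectorInternalTheory.v2r x).
  rewrite /good /r2v VectorInternalTheory.v2rK => /negbT.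
  by rewrite negb_and !negbK => /orP[]/eqP; [left | right].
have [g _ gK] := comb_bijective dimV (square_neq0 xx0) xx0 xxx.
pose y := mul x x.
exists x, (g (mul x y), g (mul y x), g (mul y y)).
by rewrite /presents !gK xx0 xxx !eqxx.
Qed.

Lemma presents_isomorphic (V W : vectType 'F_2) (mulV : {bilinear V -> V -> V})
    (mulW : {bilinear W -> W -> W}) (x : V) (y : W) (t : triple) :
  \dim (fullv : {vspace V}) = 2%N -> \dim (fullv : {vspace W}) = 2%N ->
  presents mulV x t -> presents mulW y t -> isomorphic_algebras mulV mulW.
Proof.
move=> dimV dimW presV presW.
have bijV := presents_bijective dimV presV.
have bijW := presents_bijective dimW presW.
have [g gK Kg] := bijV.
pose phi := comb y (mulW y y) \o g.
have phi_lin : linear phi.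
  by move=> a u v; rewrite /phi /= (can2_linear gK Kg) linearP.
pose phiL := GRing.isLinear.Build 'F_2 V W _ phi phi_lin.
exists (HB.pack phi phiL : {linear V -> W}); split=> [|u v] /=.
  by apply: bij_comp => //; exists (comb x (mulV x x)).
rewrite -(presents_mul _ _ presW); congr (comb _ _ _).
by apply: (can_inj gK); rewrite (presents_mul _ _ presV) !Kg.
Qed.

(** * Computations with triples *)

Definition plane_elements : seq plane :=
  [seq (a, b) | a <- F2_elements, b <- F2_elements].

Definition triples : seq triple :=
  [seq (u, r) | u <- [seq (p, q) | p <- plane_elements, q <- plane_elements],
                r <- plane_elements].

Lemma mem_plane_elements (p : plane) : p \in plane_elements.
Proof. by case: p => a b; apply: allpairs_f; apply: mem_F2_elements. Qed.

Lemma mem_triples (t : triple) : t \in triples.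
Proof.
case: t => [[p q] r]; apply: allpairs_f; last exact: mem_plane_elements.
by apply: allpairs_f; apply: mem_plane_elements.
Qed.

Definition plane_endo (t : triple) : bool :=
  all (fun p => all (fun q =>
      plane_mul t (plane_mul t p p) (plane_mul t q q)
      == plane_mul t (plane_mul t p q) (plane_mul t p q))
    plane_elements) plane_elements.

Lemma plane_endoP (t : triple) :
  reflect (forall p q, plane_mul t (plane_mul t p p) (plane_mul t q q)
                       = plane_mul t (plane_mul t p q) (plane_mul t p q))
          (plane_endo t).
Proof.
apply: (iffP allP) => [h p q | h p _].
  have /allP h' := h p (mem_plane_elements p).
  exact/eqP/h'/mem_plane_elements.
by apply/allP => q _; apply/eqP/h.
Qed.

Lemma endo_transport (T U : Type) (m : T -> T -> T) (mul : U -> U -> U)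
    (c : T -> U) :
  bijective c -> (forall p q, c (m p q) = mul (c p) (c q)) ->
  (forall v w, mul (mul v v) (mul w w) = mul (mul v w) (mul v w)) <->
  (forall p q, m (m p p) (m q q) = m (m p q) (m p q)).
Proof.
move=> c_bij cM; split=> [endo p q | endo v w].
  by apply: (bij_inj c_bij); rewrite !cM.
by have [g _ gK] := c_bij; rewrite -(gK v) -(gK w) -!cM endo.
Qed.

Lemma presents_endo (V : vectType 'F_2) (mul : {bilinear V -> V -> V}) (x : V)
    (t : triple) :
  \dim (fullv : {vspace V}) = 2%N -> presents mul x t ->
  endo_commutative mul <-> plane_endo t.
Proof.
move=> dimV pres; apply: iff_trans (rwP (plane_endoP t)).
apply: (endo_transport (presents_bijective dimV pres)) => p q.
exact: presents_mul.
Qed.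

Definition ECS_triples : 13.-tuple triple :=
  let o : plane := (0, 0) in let e : plane := (1, 0) in
  let f : plane := (0, 1) in let s : plane := (1, 1) in
  [tuple (o, f, o); (f, o, o); (s, e, f); (e, s, f); (e, e, s); (o, o, e);
         (s, s, e); (o, o, o); (f, f, o); (f, f, f); (e, e, f); (f, e, e);
         (e, f, e)].

Lemma ECS_triples_uniq : uniq ECS_triples.
Proof. by []. Qed.

Lemma ECS_triples_endo : all plane_endo ECS_triples.
Proof. by lazy. Qed.

(** The occurrences of t itself in its own algebra have to be allowed, and t
    may occur there at several elements p: these are the images of e under the
    automorphisms. *)
Lemma ECS_triples_separated :
  all (fun t => all (fun t' => all (fun p =>
      presents (plane_mul t) p t' ==> (t' == t))
    plane_elements) ECS_triples) ECS_triples.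
Proof. by lazy. Qed.

Lemma ECS_triples_exhaustive :
  all (fun t => plane_endo t ==>
    has (fun p => has (presents (plane_mul t) p) ECS_triples) plane_elements)
  triples.
Proof.
(* Lazy evaluation lets the boolean connectives short-circuit, which call by
   value would not. *)
by lazy.
Qed.

(** * The thirteen algebras *)

Definition triple_table (t : triple) : 'M['rV['F_2]_2]_2 :=
  let row (p : plane) := comb 'e_0 'e_1 p in
  table2 'e_1 (row t.1.1) (row t.1.2) (row t.2).

Lemma ECS_tablesE : ECS_tables = map_tuple triple_table ECS_triples.
Proof.
apply: val_inj; rewrite /= /triple_table /comb /=.
by rewrite !scale0r !scale1r !addr0 !add0r.
Qed.

Lemma ECS_presents (k : 'I_13) : presents (ECS k) 'e_0 (tnth ECS_triples k).
Proof.
set t := tnth ECS_triples k.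
have M i j : ECS k 'e_i 'e_j = triple_table t i j.
  by rewrite /ECS /= table_mul_delta ECS_tablesE tnth_map.
rewrite /presents !M !mxE /= !M !mxE /= !eqxx !andbT.
by apply/andP; split; apply/eqP => /matrixP/(_ 0 1); rewrite !mxE.
Qed.

Lemma dim_row2 : \dim (fullv : {vspace 'rV['F_2]_2}) = 2%N.
Proof. by rewrite dimvf. Qed.

Theorem theorem2 :
  (forall k : 'I_13, endo_commutative (ECS k) /\ straight (ECS k)) /\
  (forall k l : 'I_13, k <> l -> ~ isomorphic_algebras (ECS k) (ECS l)) /\
  (forall (V : vectType 'F_2) (mul : {bilinear V -> V -> V}),
     \dim (fullv : {vspace V}) = 2%N -> endo_commutative mul -> straight mul ->
     exists k : 'I_13, isomorphic_algebras mul (ECS k)).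
Proof.
split; [|split].
- move=> k; have pres := ECS_presents k.
  split; last exact: presents_straight pres.
  apply/(presents_endo dim_row2 pres).
  exact: (allP ECS_triples_endo _ (mem_tnth _ _)).
- move=> k l neq_kl [phi [phi_bij phiM]]; apply: neq_kl.
  have pres : presents (ECS l) (phi 'e_0) (tnth ECS_triples k).
    by rewrite (presents_morph _ _ (bij_inj phi_bij) phiM) ECS_presents.
  have presl := ECS_presents l.
  have [g _ gK] := presents_bijective dim_row2 presl.
  move: pres; rewrite -(gK (phi 'e_0)) (presents_comb _ _ dim_row2 presl).
  have /allP sep := allP ECS_triples_separated _ (mem_tnth l _).
  have /allP sepk := sep _ (mem_tnth k _).
  move/(implyP (sepk _ (mem_plane_elements _))).
  have t0 : triple := (0, 0, 0).
  rewrite !(tnth_nth t0) nth_uniq ?size_tuple ?ECS_triples_uniq //.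
  by move/eqP/val_inj.
move=> V mul dimV endo str.
have [x [t pres]] := straight_presented dimV str.
have /implyP found := allP ECS_triples_exhaustive t (mem_triples t).
case/hasP: (found (iffLR (presents_endo dimV pres) endo)) => p _.
case/hasP=> _ /tnthP[k ->] pres'; exists k.
apply: (presents_isomorphic dimV dim_row2 _ (ECS_presents k)).
  exact: (etrans (presents_comb _ _ dimV pres) pres').
Qed.
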